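(* Let $s,t\in\mathbb{C}$ with $t\neq 0$ and $0<|q|<1$, where $q=\varphi_{s,t}'/\varphi_{s,t}$, and let $u\in\mathbb{C}$. Then, as formal power series in $x$ (hence also as an identity of sums for every $x\in\mathbb{C}$ for which the series converge), $$\sum_{n=0}^{\infty}\genfrac{[}{]}{0pt}{}{2n}{n}_{q}\frac{(-u/t)^{\binom{n}{2}}}{(-\sqrt{q};q)_{n}(-q;q)_{n}(1-q^{n+1})}\left(\frac{4x}{\sqrt{-t\varphi_{s,t}}}\right)^n=\frac{1}{1-q}\;{}_{2}\Phi_{1}\left(\begin{array}{c} \sqrt{q},q \\ q^2 \end{array};q,-\frac{u}{t},\frac{4x}{\sqrt{-t\varphi_{s,t}}}\right).$$
   Context: $\varphi_{s,t}=\frac{s+\sqrt{s^2+4t}}{2}$ and $\varphi_{s,t}'=\frac{s-\sqrt{s^2+4t}}{2}$ (for a fixed choice of the square root), so that $\varphi_{s,t}\varphi_{s,t}'=-t$; $q=\varphi_{s,t}'/\varphi_{s,t}$. Square roots $\sqrt q$ and $\sqrt{-t\varphi_{s,t}}$ are fixed once and for all. $(a;q)_0=1$ and $(a;q)_n=\prod_{k=0}^{n-1}(1-aq^k)$ for $n\ge1$; $(a_1,\dots,a_m;q)_n=(a_1;q)_n\cdots(a_m;q)_n$. The $q$-binomial coefficient is $\genfrac{[}{]}{0pt}{}{n}{k}_{q}=\frac{(q;q)_n}{(q;q)_k(q;q)_{n-k}}$. The deformed basic hypergeometric series is ${}_{r}\Phi_{r'}\left(\begin{array}{c} a_1,\ldots,a_r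 \\ b_1,\ldots,b_{r'} \end{array};q,v,z\right)=\sum_{n\ge0}v^{\binom n2}\frac{(a_1,\ldots,a_r;q)_n}{(q,b_1,\ldots,b_{r'};q)_n}\bigl[(-1)^nq^{\binom n2}\bigr]^{1+r'-r}z^n$; for $r=r'+1$ the bracketed factor is $1$. Convention: $0^0=1$. *)

(* Defs.v *)
From HB Require Import structures.
From mathcomp Require Import all_boot all_order all_algebra complex.
From mathcomp Require Import all_classical all_reals all_analysis.

Set Implicit Arguments.
Unset Strict Implicit.
Unset Printing Implicit Defensive.

Import Order.TTheory GRing.Theory Num.Theory.
Import numFieldNormedType.Exports.

Local Open Scope ring_scope.
Local Open Scope complex_scope.

(* [d] is the chosen square root of [s ^+ 2 + 4 * t]; it stands for the
   dependency on [t]. *)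
Definition phi (F : fieldType) (s d : F) : F := (s + d) / 2.

Definition phi' (F : fieldType) (s d : F) : F := (s - d) / 2.

Definition qpoch (F : fieldType) (a q : F) (n : nat) : F :=
  \prod_(k < n) (1 - a * q ^+ k).

Definition qpochs (F : fieldType) (s : seq F) (q : F) (n : nat) : F :=
  \prod_(a <- s) qpoch a q n.

(* Meaningful for [k <= n] only, because [n - k] is truncated. *)
Definition qbinom (F : fieldType) (q : F) (n k : nat) : F :=
  qpoch q q n / (qpoch q q k * qpoch q q (n - k)).

(* A formal power series is identified with its sequence of coefficients. *)
Definition fps (F : fieldType) : Type := nat -> F.

Definition fps_scale (F : fieldType) (k : F) (a : fps F) : fps F :=
  fun n => k * a n.

(* The series [a (c x)], as a formal power series in [x]. *)
Definition fps_dilate (F : fieldType) (c : F) (a : fps F) : fps F :=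
  fun n => a n * c ^+ n.

(* The deformed basic hypergeometric series, as a formal power series in [z].
   The exponent 1 + r' - r is an integer, possibly negative. *)
Definition Phi_fps (F : fieldType) (aa bb : seq F) (q v : F) : fps F :=
  fun n =>
    v ^+ 'C(n, 2) * (qpochs aa q n / qpochs (q :: bb) q n) *
    ((-1) ^+ n * q ^+ 'C(n, 2)) ^ (1 + (size bb)%:Z - (size aa)%:Z).

(* [R[i]^o] is [R[i]] with the topology given by its modulus. *)
Definition fps_terms (R : realType) (a : fps R[i]) (z : R[i]) : nat -> R[i]^o :=
  fun n => a n * z ^+ n.

Definition fps_cvg (R : realType) (a : fps R[i]) (z : R[i]) : Prop :=
  cvgn (series (fps_terms a z)).

(* This is the sum of the series only under [fps_cvg a z]. *)
Definition fps_sum (R : realType) (a : fps R[i]) (z : R[i]) : R[i] :=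
  limn (series (fps_terms a z)).

Definition Phi (R : realType) (aa bb : seq R[i]) (q v z : R[i]) : R[i] :=
  fps_sum (Phi_fps aa bb q v) z.

(* Main.v *)
Require Import Defs.
From HB Require Import structures.
From mathcomp Require Import all_boot all_order all_algebra complex.
From mathcomp Require Import all_classical all_reals all_analysis.
From mathcomp Require Import ring.

Import Order.TTheory GRing.Theory Num.Theory.
Import numFieldNormedType.Exports.

Local Open Scope ring_scope.
Local Open Scope complex_scope.

(** The identity holds coefficient by coefficient.  Grouping the factors of
    (q; q)_(2n) by the parity of the exponent of q gives
    (q; q^2)_n (q^2; q^2)_n, and since q = p^2 for p the chosen square root of
    q, each half splits by a difference of squares:
      (q; q)_(2n) = (p; q)_n (-p; q)_n (q; q)_n (-q; q)_n    [qpoch_double].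
    The two factors with a minus sign are exactly those in the denominator on
    the left, and what remains of the q-binomial coefficient is
    (p; q)_n / (q; q)_n.  No denominator vanishes: |q| < 1 forbids q^m = 1 for
    m > 0, hence (q; q)_(2n) and all its factors are nonzero.  On the right,
    (1 - q) (q^2; q)_n = (q; q)_n (1 - q^(n+1)) [qpoch_shift] turns the lower
    parameter q^2 into the factor 1 - q^(n+1).

    The assertions on sums follow because multiplying all the coefficients of a
    series by one nonzero constant preserves convergence and multiplies the sum
    by that constant. *)

Section QPochhammer.
Variables (F : fieldType) (q : F).
Hypothesis q_neq1 : forall m, q ^+ m.+1 != 1.

Lemma qpochS (a : F) n : qpoch a q n.+1 = qpoch a q n * (1 - a * q ^+ n).
Proof. by rewrite /qpoch big_ord_recr. Qed.

(** Both sides are (q; q)_(n+1), with either the first or the last factor split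
    off. *)
Lemma qpoch_shift n :
  (1 - q) * qpoch (q ^+ 2) q n = qpoch q q n * (1 - q ^+ n.+1).
Proof.
rewrite [in RHS]exprS -qpochS /qpoch big_ord_recl expr0 mulr1.
by congr (_ * _); apply: eq_bigr => i _; rewrite lift0 expr2 exprS mulrA.
Qed.

(** The two factors that the left side gains when n grows by one are
    1 - q^(2n+1) and 1 - q^(2n+2); as p^2 = q, each is a difference of squares. *)
Lemma qpoch_double (p : F) n : p ^+ 2 = q ->
  qpoch q q (2 * n) =
    qpoch p q n * qpoch (- p) q n * (qpoch q q n * qpoch (- q) q n).
Proof.
move=> pq; elim: n => [|n IHn]; first by rewrite muln0 /qpoch !big_ord0 !mulr1.
rewrite mulnS !qpochS IHn.
have -> : q ^+ (2 * n).+1 = q * (q ^+ n) ^+ 2 by rewrite exprS mulnC exprM.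
have -> : q ^+ (2 * n) = (q ^+ n) ^+ 2 by rewrite mulnC exprM.
have -> : 1 - q * (q ^+ n) ^+ 2 = (1 - p * q ^+ n) * (1 - - p * q ^+ n).
  by rewrite -[in X in X * (_ ^+ 2)]pq; ring.
ring.
Qed.

Lemma qpoch_neq0 n : qpoch q q n != 0.
Proof.
by apply/prodf_neq0 => i _; rewrite -exprS subr_eq0 eq_sym q_neq1.
Qed.

(** The denominators (-p; q)_n and (-q; q)_n do not vanish, being factors of
    (q; q)_(2n), which is nonzero as no positive power of q is 1. *)
Lemma coef_identity (p v : F) n : p ^+ 2 = q ->
  qbinom q (2 * n) n *
    (v ^+ 'C(n, 2) /
      (qpoch (- p) q n * qpoch (- q) q n * (1 - q ^+ n.+1))) =
  1 / (1 - q) * Phi_fps [:: p; q] [:: q ^+ 2] q v n.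
Proof.
move=> pq; have := qpoch_neq0 (2 * n).
rewrite (qpoch_double p n pq) !mulf_eq0 !negb_or.
case/andP => /andP[_ Np0] /andP[q0 Nq0].
have n0 : 1 - q ^+ n.+1 != 0 by rewrite subr_eq0 eq_sym q_neq1.
have q1 : 1 - q != 0 by rewrite subr_eq0 eq_sym (q_neq1 0).
have q2E : qpoch (q ^+ 2) q n = qpoch q q n * (1 - q ^+ n.+1) / (1 - q).
  by rewrite -qpoch_shift mulrAC divff // mul1r.
(* For two upper parameters and one lower one, the exponent 1 + 1 - 2 of the
   bracketed factor is zero. *)
rewrite /Phi_fps /= expr0z mulr1 /qpochs !big_cons !big_nil !mulr1 q2E.
rewrite /qbinom (qpoch_double p n pq) mul2n -addnn addnK.
move: (1 - q ^+ n.+1) n0 => c c0.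
field.
by rewrite q0 q1 c0 Np0 Nq0.
Qed.

End QPochhammer.

Section Scaling.
Variables (R : realType) (k : R[i]) (a : fps R[i]) (z : R[i]).

Lemma series_fps_scale :
  series (fps_terms (fps_scale k a) z) =
    (fun n => (k : R[i]^o) *: series (fps_terms a z) n).
Proof.
apply/funext => n; rewrite /series /= scaler_sumr.
by apply: eq_bigr => i _; rewrite /fps_terms /fps_scale -mulrA.
Qed.

Lemma fps_cvg_scale : k != 0 -> fps_cvg (fps_scale k a) z <-> fps_cvg a z.
Proof.
by move=> k0; rewrite /fps_cvg series_fps_scale is_cvgZlE.
Qed.

Lemma fps_sum_scale :
  fps_cvg a z -> fps_sum (fps_scale k a) z = k * fps_sum a z.
Proof.
by move=> cvga; rewrite /fps_sum series_fps_scale limZl_tmp.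
Qed.

End Scaling.

Theorem theorem6 (R : realType) (s t u d sqrtq r : R[i]) :
  let q := phi' s d / phi s d in
  t != 0 ->
  d ^+ 2 = s ^+ 2 + 4 * t ->
  0 < `|q| < 1 ->
  sqrtq ^+ 2 = q ->
  r ^+ 2 = - t * phi s d ->
  let a : fps R[i] := fun n =>
    qbinom q (2 * n) n *
    ((- u / t) ^+ 'C(n, 2) /
     (qpoch (- sqrtq) q n * qpoch (- q) q n * (1 - q ^+ n.+1))) in
  fps_dilate (4 / r) a =
    fps_scale (1 / (1 - q))
      (fps_dilate (4 / r) (Phi_fps [:: sqrtq; q] [:: q ^+ 2] q (- u / t)))
  /\
  forall x : R[i],
    let z := 4 * x / r in
    (fps_cvg a z <-> fps_cvg (Phi_fps [:: sqrtq; q] [:: q ^+ 2] q (- u / t)) z)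
    /\
    (fps_cvg a z ->
       fps_sum a z =
         1 / (1 - q) * Phi [:: sqrtq; q] [:: q ^+ 2] q (- u / t) z).
Proof.
move=> q _ _ /andP[_ q_lt1] pq _ a.
have q_neq1 m : q ^+ m.+1 != 1.
  apply/eqP => /(congr1 Num.norm); rewrite normrX normr1 => qm1.
  by have := exprn_ilt1 m.+1 (normr_ge0 q) q_lt1; rewrite qm1 ltxx.
have k0 : 1 / (1 - q) != 0.
  by rewrite div1r invr_eq0 subr_eq0 eq_sym (q_neq1 0).
have -> : a = fps_scale (1 / (1 - q))
    (Phi_fps [:: sqrtq; q] [:: q ^+ 2] q (- u / t)).
  by apply/funext => n; apply: coef_identity.
split.
  by apply/funext => n; rewrite /fps_dilate /fps_scale mulrA.
move=> x z; split; first exact: (fps_cvg_scale _ _ _ _ k0).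
by move=> /(fps_cvg_scale _ _ _ _ k0) cvgPhi; apply: fps_sum_scale.
Qed.
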